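(* Every local residuated lattice has the Boolean Lifting Property (BLP). Moreover, if $A$ is a local residuated lattice and $F$ is a proper filter of $A$, then the map $\mathcal{B}(p_F):\mathcal{B}(A)\rightarrow \mathcal{B}(A/F)$, $e\mapsto e/F$, is a bijection.
   Context: A residuated lattice is a commutative integral bounded one: a structure $(A,\vee ,\wedge ,\odot ,\rightarrow ,0,1)$ such that $(A,\vee ,\wedge ,0,1)$ is a bounded lattice, $(A,\odot ,1)$ is a commutative monoid, and $a\leq b\rightarrow c$ iff $a\odot b\leq c$ for all $a,b,c$. Write $a\leftrightarrow b=(a\rightarrow b)\wedge (b\rightarrow a)$. $\mathcal{B}(A)$ is the set of complemented elements of the bounded lattice reduct of $A$. A filter of $A$ is a nonempty subset closed under $\odot$ and upward closed; it is proper iff it is not equal to $A$; a maximal filter is a maximal element, under inclusion, of the set of proper filters. $A$ is local iff it has exactly one maximal filter. For a filter $F$, $A/F$ is the quotient residuated lattice by the congruence $a\equiv b$ iff $a\leftrightarrow b\in F$, with classes $a/F$, and $p_F:A\to A/F$ is the canonical surjection. $F$ has BLP iff for every $f\in \mathcal{B}(A/F)$ there is $e\in \mathcal{B}(A)$ with $e/F=f$. $A$ has BLP iff all its filters have BLP. *)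

(* Defs.v *)
From HB Require Import structures.
From mathcomp Require Import all_boot all_order.
From mathcomp Require Import boolp classical_sets functions.
Set Implicit Arguments.
Unset Strict Implicit.
Unset Printing Implicit Defensive.
Import Order.TTheory.
Local Open Scope classical_set_scope.
Local Open Scope order_scope.
Local Open Scope quotient_scope.

Reserved Notation "a \odot b" (at level 40, left associativity).
Reserved Notation "a \imp b" (at level 55, right associativity).
Reserved Notation "a \bimp b" (at level 55, no associativity).

(* The one-element algebra (\bot = \top) is allowed. *)
HB.mixin Record isResiduatedLattice (d : Order.disp_t) A
    of Order.TBLattice d A := {
  rlmul : A -> A -> A;
  rlimp : A -> A -> A;
  rlmulA : associative rlmul;
  rlmulC : commutative rlmul;
  rlmulx1 : right_id \top rlmul;
  rl_residuation : forall a b c : A, (a <= rlimp b c) = (rlmul a b <= c)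
}.

#[short(type="residuatedLatticeType")]
HB.structure Definition ResiduatedLattice (d : Order.disp_t) :=
  { A of isResiduatedLattice d A & Order.TBLattice d A }.

Notation "a \odot b" := (rlmul a b) : order_scope.
Notation "a \imp b" := (rlimp a b) : order_scope.

Definition rlbimp (d : Order.disp_t) (A : residuatedLatticeType d) (a b : A) : A :=
  (a \imp b) `&` (b \imp a).
Notation "a \bimp b" := (rlbimp a b) : order_scope.

Definition complemented_set (d : Order.disp_t) (L : tbLatticeType d) : set L :=
  [set x | exists y : L, x `&` y = \bot /\ x `|` y = \top].
Arguments complemented_set {d} L _.

Definition is_rlfilter (d : Order.disp_t) (A : residuatedLatticeType d)
    (F : set A) : Prop :=
  [/\ F !=set0,
      forall a b, F a -> F b -> F (a \odot b)
    & forall a b, F a -> a <= b -> F b].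

Record rlfilter (d : Order.disp_t) (A : residuatedLatticeType d) := RLFilter {
  rlfilter_set :> set A;
  rlfilterP : is_rlfilter rlfilter_set }.

Definition proper_rlfilter (d : Order.disp_t) (A : residuatedLatticeType d)
    (F : set A) : Prop :=
  is_rlfilter F /\ F <> [set: A].

Definition maximal_rlfilter (d : Order.disp_t) (A : residuatedLatticeType d)
    (M : set A) : Prop :=
  proper_rlfilter M /\
  forall G : set A, proper_rlfilter G -> M `<=` G -> G = M.

Definition local_rl (d : Order.disp_t) (A : residuatedLatticeType d) : Prop :=
  exists! M : set A, maximal_rlfilter M.

Section ResiduatedLatticeTheory.
Variables (d : Order.disp_t) (A : residuatedLatticeType d).
Implicit Types a b c : A.

Lemma rlmul1x a : \top \odot a = a. Proof. by rewrite rlmulC rlmulx1. Qed.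

Lemma rl_eval a b : (a \imp b) \odot a <= b.
Proof. by rewrite -rl_residuation. Qed.

Lemma rlmul_monol c a b : a <= b -> a \odot c <= b \odot c.
Proof.
by move=> ab; rewrite -rl_residuation (le_trans ab)// rl_residuation.
Qed.

Lemma rlmul_lel a b : a \odot b <= a.
Proof. by rewrite -[leRHS]rlmul1x rlmulC -rl_residuation (le_trans (lex1 b))//
  rl_residuation. Qed.

Lemma rlimp_top a b : a <= b -> a \imp b = \top.
Proof. by move=> ab; apply/eqP; rewrite -le1x rl_residuation rlmul1x. Qed.

Lemma rlimp_mul a b c : (a \odot b) \imp c = a \imp (b \imp c).
Proof.
apply/eqP; rewrite eq_le; apply/andP; split.
  by rewrite !rl_residuation -rlmulA rl_eval.
rewrite rl_residuation rlmulA -rl_residuation; exact: rl_eval.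
Qed.

Lemma rlimp_meet a b c : a \imp (b `&` c) = (a \imp b) `&` (a \imp c).
Proof.
apply/eqP; rewrite eq_le; apply/andP; split.
  rewrite lexI !rl_residuation !(le_trans (rl_eval _ _))//; [exact: leIr|exact: leIl].
rewrite rl_residuation lexI -!rl_residuation leIl leIr//.
Qed.

Lemma rlmul_monor c a b : a <= b -> c \odot a <= c \odot b.
Proof. by move=> ab; rewrite (rlmulC c a) (rlmulC c b) rlmul_monol. Qed.

Lemma rlimp_join a b c : (a `|` b) \imp c = (a \imp c) `&` (b \imp c).
Proof.
apply/eqP; rewrite eq_le; apply/andP; split.
  rewrite lexI !rl_residuation.
  by rewrite !(le_trans (rlmul_monor _ _) (rl_eval _ _)) ?leUl ?leUr.
rewrite rl_residuation rlmulC -rl_residuation leUx !rl_residuation.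
rewrite (rlmulC a) (rlmulC b) -!rl_residuation leIl leIr//.
Qed.

Lemma rlimp_trans a b c : (a \imp b) \odot (b \imp c) <= a \imp c.
Proof.
rewrite rl_residuation (rlmulC (a \imp b)) -rlmulA.
exact: le_trans (rlmul_monor _ (rl_eval a b)) (rl_eval b c).
Qed.

End ResiduatedLatticeTheory.

Section Quotient.
Variables (d : Order.disp_t) (A : residuatedLatticeType d) (F : rlfilter A).
Implicit Types a b c : A.

Definition rlcong : rel A := fun a b => `[< rlfilter_set F (a \bimp b) >].

Let fle a b : bool := `[< rlfilter_set F (a \imp b) >].

Lemma rlfilter_top : rlfilter_set F \top.
Proof. by case: (rlfilterP F) => -[x Fx] _ /(_ x \top Fx (lex1 x)). Qed.

Lemma rlfilter_up a b : rlfilter_set F a -> a <= b -> rlfilter_set F b.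
Proof. by case: (rlfilterP F) => _ _; apply. Qed.

Lemma rlfilter_mul a b :
  rlfilter_set F a -> rlfilter_set F b -> rlfilter_set F (a \odot b).
Proof. by case: (rlfilterP F) => _ + _; apply. Qed.

Lemma rlfilter_meet a b : `[< rlfilter_set F (a `&` b) >] = `[< rlfilter_set F a >] && `[< rlfilter_set F b >].
Proof.
apply/asboolP/andP => [Fab|[/asboolP Fa /asboolP Fb]].
  by split; apply/asboolP; apply: rlfilter_up Fab _; [exact: leIl|exact: leIr].
apply: rlfilter_up (rlfilter_mul Fa Fb) _.
by rewrite lexI rlmul_lel rlmulC rlmul_lel.
Qed.

Lemma rlcongE a b : rlcong a b = fle a b && fle b a.
Proof. exact: rlfilter_meet. Qed.

Let fleW a b : a <= b -> fle a b.
Proof. by move=> /rlimp_top ab; apply/asboolP; rewrite ab; exact: rlfilter_top. Qed.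

Let fle_refl : reflexive fle. Proof. by move=> a; exact: fleW. Qed.

Let fle_trans : transitive fle.
Proof.
move=> b a c /asboolP ab /asboolP bc; apply/asboolP.
exact: rlfilter_up (rlfilter_mul ab bc) (rlimp_trans _ _ _).
Qed.

Let fle_meet a b c : fle a (b `&` c) = fle a b && fle a c.
Proof. by rewrite /fle rlimp_meet rlfilter_meet. Qed.

Let fle_join a b c : fle (a `|` b) c = fle a c && fle b c.
Proof. by rewrite /fle rlimp_join rlfilter_meet. Qed.

Let fle_res a b c : fle a (b \imp c) = fle (a \odot b) c.
Proof. by rewrite /fle rlimp_mul. Qed.

Let fle_mul a a' b b' : fle a a' -> fle b b' -> fle (a \odot b) (a' \odot b').
Proof.
have mono x y z : fle x y -> fle (x \odot z) (y \odot z).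
  by move=> xy; rewrite -fle_res (fle_trans xy)// fle_res.
by move=> aa bb; apply: fle_trans (mono _ _ b aa) _; rewrite (rlmulC a' b) (rlmulC a' b') mono.
Qed.

Let fle_imp a a' b b' : fle a' a -> fle b b' -> fle (a \imp b) (a' \imp b').
Proof.
move=> aa bb; rewrite fle_res (fle_trans _ bb)//.
by apply: (fle_trans (fle_mul (fle_refl _) aa)); rewrite -fle_res.
Qed.

Lemma rlcong_is_equiv : equiv_class_of rlcong.
Proof.
split=> [a|a b|b a c]; rewrite !rlcongE ?fle_refl//; first by rewrite andbC.
by case/andP=> ab ba /andP[bc cb]; rewrite (fle_trans ab) ?(fle_trans cb).
Qed.

Canonical rlcong_equiv := EquivRelPack rlcong_is_equiv.

Definition rlquot : Type := {eq_quot rlcong}.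
HB.instance Definition _ := Choice.on rlquot.
HB.instance Definition _ := EqQuotient.on rlquot.

Definition rlproj (a : A) : rlquot := \pi_rlquot a.

Definition rlquot_le (x y : rlquot) : bool := `[< rlfilter_set F (repr x \imp repr y) >].
Definition rlquot_meet (x y : rlquot) := rlproj (repr x `&` repr y).
Definition rlquot_join (x y : rlquot) := rlproj (repr x `|` repr y).
Definition rlquot_mul (x y : rlquot) := rlproj (repr x \odot repr y).
Definition rlquot_imp (x y : rlquot) := rlproj (repr x \imp repr y).

Lemma rlproj_eqP a b : rlproj a = rlproj b <-> rlfilter_set F (a \bimp b).
Proof.
rewrite /rlproj; split=> [/eqP|ab].
  by rewrite eqmodE => /asboolP.
by apply/eqP; rewrite eqmodE; apply/asboolP.
Qed.

Let rlproj_eq a b : fle a b -> fle b a -> rlproj a = rlproj b.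
Proof.
by move=> ab ba; apply/rlproj_eqP/asboolP; rewrite -/(rlcong a b) rlcongE ab ba.
Qed.

Let reprE a : fle (repr (rlproj a)) a && fle a (repr (rlproj a)).
Proof.
rewrite -rlcongE; apply/asboolP/rlproj_eqP; exact: reprK.
Qed.

Let repr_le a : fle (repr (rlproj a)) a. Proof. by have /andP[] := reprE a. Qed.
Let repr_ge a : fle a (repr (rlproj a)). Proof. by have /andP[] := reprE a. Qed.

Let rlproj_repr x : rlproj (repr x) = x. Proof. exact: reprK. Qed.

Let rlproj_surj x : {a | x = rlproj a}.
Proof. by exists (repr x). Qed.

Let rlproj_le a b : rlquot_le (rlproj a) (rlproj b) = fle a b.
Proof.
apply/idP/idP => ab.
  exact: fle_trans (repr_ge a) (fle_trans ab (repr_le b)).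
exact: fle_trans (repr_le a) (fle_trans ab (repr_ge b)).
Qed.

Let rlproj_lel a y : rlquot_le (rlproj a) y = fle a (repr y).
Proof. by rewrite -[y in LHS]rlproj_repr rlproj_le. Qed.

Let rlproj_ler x b : rlquot_le x (rlproj b) = fle (repr x) b.
Proof. by rewrite -[x in LHS]rlproj_repr rlproj_le. Qed.

Let rlquot_le_refl : reflexive rlquot_le.
Proof. by move=> x; exact: fle_refl. Qed.

Let rlquot_le_anti : antisymmetric rlquot_le.
Proof.
move=> x y; have [a ->] := rlproj_surj x; have [b ->] := rlproj_surj y.
by rewrite !rlproj_le => /andP[]; exact: rlproj_eq.
Qed.

Let rlquot_le_trans : transitive rlquot_le.
Proof. by move=> y x z; exact: fle_trans. Qed.

HB.instance Definition _ := Order.Le_isPOrder.Build d rlquot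
  rlquot_le_refl rlquot_le_anti rlquot_le_trans.

Let rlquot_lexI (x y z : rlquot) :
  (x <= rlquot_meet y z) = (x <= y) && (x <= z).
Proof. by rewrite /Order.le/= rlproj_ler fle_meet. Qed.

Let rlquot_leUx (x y z : rlquot) :
  (rlquot_join x y <= z) = (x <= z) && (y <= z).
Proof. by rewrite /Order.le/= rlproj_lel fle_join. Qed.

HB.instance Definition _ := Order.POrder_MeetJoin_isLattice.Build d rlquot
  rlquot_lexI rlquot_leUx.

Let rlquot_le0x (x : rlquot) : rlproj \bot <= x.
Proof. by rewrite /Order.le/= rlproj_lel fleW. Qed.

Let rlquot_lex1 (x : rlquot) : x <= rlproj \top.
Proof. by rewrite /Order.le/= rlproj_ler fleW. Qed.

HB.instance Definition _ := Order.hasBottom.Build d rlquot rlquot_le0x.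
HB.instance Definition _ := Order.hasTop.Build d rlquot rlquot_lex1.

Let rlproj_mul_subproof a b :
  rlquot_mul (rlproj a) (rlproj b) = rlproj (a \odot b).
Proof. by apply: rlproj_eq; apply: fle_mul. Qed.

Let rlquot_mulA : associative rlquot_mul.
Proof.
move=> x y z; have [a ->] := rlproj_surj x; have [b ->] := rlproj_surj y.
by have [c ->] := rlproj_surj z; rewrite !rlproj_mul_subproof rlmulA.
Qed.

Let rlquot_mulC : commutative rlquot_mul.
Proof. by move=> x y; rewrite /rlquot_mul rlmulC. Qed.

Let rlquot_mulx1 : right_id \top rlquot_mul.
Proof. by move=> x; have [a ->] := rlproj_surj x; rewrite rlproj_mul_subproof rlmulx1. Qed.

Let rlquot_residuation (x y z : rlquot) :
  (x <= rlquot_imp y z) = (rlquot_mul x y <= z).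
Proof. by rewrite /Order.le/= rlproj_lel rlproj_ler fle_res. Qed.

HB.instance Definition _ := isResiduatedLattice.Build d rlquot
  rlquot_mulA rlquot_mulC rlquot_mulx1 rlquot_residuation.

(* The lemmas below characterise the structure of [rlquot] independently of the
   chosen representatives: it is the quotient residuated lattice. *)
Lemma rlproj_surjective (x : rlquot) : exists a, rlproj a = x.
Proof. by exists (repr x). Qed.

Lemma rlproj_leE a b : (rlproj a <= rlproj b) = `[< rlfilter_set F (a \imp b) >].
Proof. exact: rlproj_le. Qed.

Lemma rlproj0 : rlproj \bot = \bot. Proof. by []. Qed.

Lemma rlproj1 : rlproj \top = \top. Proof. by []. Qed.

Lemma rlprojI a b : rlproj (a `&` b) = rlproj a `&` rlproj b.
Proof.
apply: rlproj_eq; rewrite fle_meet; apply/andP; split.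
- exact: fle_trans (fleW (leIl _ _)) (repr_ge _).
- exact: fle_trans (fleW (leIr _ _)) (repr_ge _).
- exact: fle_trans (fleW (leIl _ _)) (repr_le _).
- exact: fle_trans (fleW (leIr _ _)) (repr_le _).
Qed.

Lemma rlprojU a b : rlproj (a `|` b) = rlproj a `|` rlproj b.
Proof.
apply: rlproj_eq; rewrite fle_join; apply/andP; split.
- exact: fle_trans (repr_ge _) (fleW (leUl _ _)).
- exact: fle_trans (repr_ge _) (fleW (leUr _ _)).
- exact: fle_trans (repr_le _) (fleW (leUl _ _)).
- exact: fle_trans (repr_le _) (fleW (leUr _ _)).
Qed.

Lemma rlprojM a b : rlproj (a \odot b) = rlproj a \odot rlproj b.
Proof. by rewrite -rlproj_mul_subproof. Qed.

Lemma rlproj_imp a b : rlproj (a \imp b) = rlproj a \imp rlproj b.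
Proof. by apply: rlproj_eq; apply: fle_imp. Qed.

End Quotient.

Definition filter_has_BLP (d : Order.disp_t) (A : residuatedLatticeType d)
    (F : rlfilter A) : Prop :=
  forall f : rlquot F, complemented_set (rlquot F) f ->
    exists2 e : A, complemented_set A e & rlproj F e = f.

Definition has_BLP (d : Order.disp_t) (A : residuatedLatticeType d) : Prop :=
  forall F : rlfilter A, filter_has_BLP F.

(* Main.v *)
Require Import Defs.
From mathcomp Require Import all_boot all_order.
From mathcomp Require Import boolp classical_sets functions.

(** Let [M] be the maximal filter of a local residuated lattice [A]. By Zorn's
    lemma [M] contains every proper filter ([local_rl_maxP]); applied to the
    filter generated by an element, this shows that an element outside [M] is
    nilpotent. Let [F] be a proper filter and let [a/F] and [b/F] be
    complementary in [A/F]. The element [c = (a /\ b) -> 0] lies in [F], hence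
    in [M], and [a * b * c = 0]; as [0] is not in [M], one of [a], [b] is
    outside [M] and so is nilpotent ([local_rl_nilpotent]). Complemented
    elements are idempotent ([complement_idem]), so the nilpotent one has class
    [0], and therefore [a/F] is [0] or [1]. The same reasoning with [c = 1]
    gives that the complemented elements of [A] itself are [0] and [1]. Thus
    [e |-> e/F] is a map between the sets {0, 1} of complemented elements that
    preserves [0] and [1], and [0/F <> 1/F] because [F] is proper. The improper
    filter has a one-element quotient, where lifting is trivial. *)

Set Implicit Arguments.
Unset Strict Implicit.
Unset Printing Implicit Defensive.
Import Order.TTheory.
Local Open Scope classical_set_scope.
Local Open Scope order_scope.

Section Powers.
Variables (d : Order.disp_t) (A : residuatedLatticeType d).
Implicit Types (a b x y : A) (n : nat).

(** The [n]-th power of [a] for the monoid operation, with [rlpow a 0 = 1]. *)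
Definition rlpow a n : A := iter n (rlmul a) \top.

(** Some power of [a] is the bottom element. *)
Definition rlnilpotent a : Prop := exists n, rlpow a n = \bot.

Lemma rlpowD a m n : rlpow a (m + n) = rlpow a m \odot rlpow a n.
Proof.
elim: m => [|m IH]; first by rewrite add0n rlmul1x.
by rewrite addSn /rlpow !iterS -!/(rlpow _ _) IH rlmulA.
Qed.

Lemma rlpow1 a : rlpow a 1 = a.
Proof. exact: rlmulx1. Qed.

Lemma rlmulUr_le a x y : a \odot (x `|` y) <= (a \odot x) `|` (a \odot y).
Proof.
rewrite rlmulC -rl_residuation leUx !rl_residuation.
by rewrite (rlmulC x) (rlmulC y) leUl leUr.
Qed.

(** Multiplying [x \/ y = 1] by [x] leaves [x * x], since
    [x * y <= x /\ y = 0]. *)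
Lemma complement_idem x y : x `&` y = \bot -> x `|` y = \top -> x \odot x = x.
Proof.
move=> xy0 xy1; apply/eqP; rewrite eq_le rlmul_lel /=.
have := rlmulUr_le x x y; rewrite xy1 rlmulx1.
suff -> : x \odot y = \bot by rewrite joinx0.
by apply/eqP; rewrite -lex0 -xy0 lexI rlmul_lel rlmulC rlmul_lel.
Qed.

Lemma idem_nilpotent x : x \odot x = x -> rlnilpotent x -> x = \bot.
Proof.
move=> xx [n xn0]; apply/eqP; rewrite -lex0 -xn0 {xn0}.
elim: n => [|n IH]; first exact: lex1.
by rewrite /rlpow iterS -/(rlpow x n) -[leLHS]xx rlmul_monor.
Qed.

Lemma complement_nilpotent x y : x `&` y = \bot -> x `|` y = \top ->
  rlnilpotent x \/ rlnilpotent y -> x = \bot \/ x = \top.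
Proof.
move=> xy0 xy1 [xn|yn]; [left|right].
  exact: idem_nilpotent (complement_idem xy0 xy1) xn.
have yx : y \odot y = y.
  by apply: (@complement_idem y x); rewrite 1?meetC 1?joinC.
by rewrite -xy1 (idem_nilpotent yx yn) joinx0.
Qed.

Lemma complemented_bot : complemented_set A \bot.
Proof. by exists \top; rewrite meet0x join0x. Qed.

Lemma complemented_top : complemented_set A \top.
Proof. by exists \bot; rewrite meetx0 joinx0. Qed.

End Powers.

Section Filters.
Variables (d : Order.disp_t) (A : residuatedLatticeType d).
Implicit Types (a b c : A) (F G M : set A).

Lemma rlfilter_botP F : is_rlfilter F -> F \bot <-> F = [set: A].
Proof.
move=> [_ _ Fup]; split=> [F0|->//].
by apply/seteqP; split=> // x _; exact: Fup F0 (le0x x).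
Qed.

Lemma proper_rlfilterP F : proper_rlfilter F <-> is_rlfilter F /\ ~ F \bot.
Proof.
split=> -[Ff F0]; split=> // F1; apply: F0.
  exact/rlfilter_botP.
by rewrite F1.
Qed.

(** The filter generated by [a]. *)
Definition rlgenerated a : set A := [set b | exists n, rlpow a n <= b].

Lemma rlgenerated_filter a : is_rlfilter (rlgenerated a).
Proof.
split.
- by exists \top, 0%N.
- move=> b c [m mb] [n nc]; exists (m + n)%N; rewrite rlpowD.
  exact: le_trans (rlmul_monol _ mb) (rlmul_monor _ nc).
- by move=> b c [n nb] bc; exists n; exact: le_trans nb bc.
Qed.

Lemma rlgenerated_mem a : rlgenerated a a.
Proof. by exists 1%N; rewrite rlpow1. Qed.

Lemma rlgenerated_proper a : ~ rlnilpotent a -> proper_rlfilter (rlgenerated a).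
Proof.
move=> an; apply/proper_rlfilterP; split; first exact: rlgenerated_filter.
by move=> [n]; rewrite lex0 => /eqP an0; apply: an; exists n.
Qed.

Lemma proper_rlfilter_bigcup (C : set (set A)) : C !=set0 ->
  total_on C subset -> C `<=` @proper_rlfilter d A ->
  proper_rlfilter (\bigcup_(X in C) X).
Proof.
move=> [X0 CX0] Ctot Cp; apply/proper_rlfilterP; split; first split.
- by have [[[x X0x] _ _] _] := Cp _ CX0; exists x, X0.
- move=> a b [X CX Xa] [Y CY Yb].
  have [XY|YX] := Ctot _ _ CX CY.
    by have [[_ Ym _] _] := Cp _ CY; exists Y => //; apply: Ym => //; exact: XY.
  by have [[_ Xm _] _] := Cp _ CX; exists X => //; apply: Xm => //; exact: YX.
- move=> a b [X CX Xa] ab; exists X => //.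
  by have [[_ _ Xup] _] := Cp _ CX; exact: Xup Xa ab.
- by move=> [X CX X0b]; have /proper_rlfilterP[_] := Cp _ CX; exact.
Qed.

Lemma maximal_rlfilter_exists F : proper_rlfilter F ->
  exists2 M, maximal_rlfilter M & F `<=` M.
Proof.
move=> Fp.
(* The union of the empty chain is empty, hence not a filter: Zorn's lemma is
   applied to the sets whose union with [F] is a proper filter. *)
have [|X [Xp Xmax]] :=
    @Zorn_bigcup A [set X | proper_rlfilter (F `|` X)%classic].
  move=> C Cp Ctot /=.
  have [[X0 CX0]|C0] := pselect (C !=set0); last first.
    suff -> : \bigcup_(X in C) X = set0 by rewrite setU0.
    by rewrite -subset0 => x [X CX _]; apply: C0; exists X.
  have -> : (F `|` \bigcup_(X in C) X)%classic =
      \bigcup_(Y in [set (F `|` X)%classic | X in C]) Y.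
    apply/seteqP; split=> x.
      case=> [Fx|[X CX Xx]].
        by exists (F `|` X0)%classic; [exists X0|left].
      by exists (F `|` X)%classic; [exists X|right].
    move=> [_ [X CX <-]] [Fx|Xx]; first by left.
    by right; exists X.
  apply: proper_rlfilter_bigcup.
  - by exists (F `|` X0)%classic, X0.
  - move=> _ _ [X CX <-] [Y CY <-].
    by have [XY|YX] := Ctot _ _ CX CY; [left|right]; apply: setUS.
  - by move=> _ [X CX <-]; exact: Cp.
exists (F `|` X)%classic; last exact: subsetUl.
split=> // G Gp FXG; apply/seteqP; split=> //.
apply: contrapT => nGFX; apply: (Xmax G).
  split; first by move=> x Xx; apply: FXG; right.
  by move=> GX; apply: nGFX; apply: subset_trans GX (@subsetUr _ _ _).
by rewrite /= setUidr// => x Fx; apply: FXG; left.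
Qed.

Lemma local_rl_maxP : local_rl A ->
  exists2 M : set A, proper_rlfilter M &
    forall F, proper_rlfilter F -> F `<=` M.
Proof.
move=> [M [[Mp _] Muniq]]; exists M => // F Fp.
by have [N Nmax FN] := maximal_rlfilter_exists Fp; rewrite (Muniq _ Nmax).
Qed.

Lemma local_rl_nilpotent F a b c : local_rl A -> proper_rlfilter F -> F c ->
  a \odot b \odot c = \bot -> rlnilpotent a \/ rlnilpotent b.
Proof.
move=> /local_rl_maxP[M /proper_rlfilterP[[_ Mmul _] M0] Mmax] Fp Fc abc0.
have nilM x : ~ rlnilpotent x -> M x.
  by move=> /rlgenerated_proper /Mmax; apply; exact: rlgenerated_mem.
have [|an] := pselect (rlnilpotent a); first by left.
have [|bn] := pselect (rlnilpotent b); first by right.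
exfalso; apply: M0; rewrite -abc0.
exact: Mmul (Mmul _ _ (nilM _ an) (nilM _ bn)) (Mmax _ Fp _ Fc).
Qed.

Lemma local_rl_complemented a : local_rl A -> complemented_set A a ->
  a = \bot \/ a = \top.
Proof.
move=> Al [b [ab0 ab1]]; apply: (complement_nilpotent ab0 ab1).
have [M Mp _] := local_rl_maxP Al.
have [[x Mx] _ Mup] := Mp.1.
apply: (local_rl_nilpotent Al Mp (Mup _ \top Mx (lex1 x))).
by apply/eqP; rewrite rlmulx1 -lex0 -ab0 lexI rlmul_lel rlmulC rlmul_lel.
Qed.

End Filters.

Section QuotientOfLocal.
Variables (d : Order.disp_t) (A : residuatedLatticeType d) (F : rlfilter A).

Lemma rlproj_pow (a : A) n : rlproj F (rlpow a n) = rlpow (rlproj F a) n.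
Proof. by elim: n => [//|n IH]; rewrite /rlpow !iterS rlprojM IH. Qed.

Lemma rlproj_nilpotent (a : A) : rlnilpotent a -> rlnilpotent (rlproj F a).
Proof. by move=> [n an0]; exists n; rewrite -rlproj_pow an0 rlproj0. Qed.

Lemma rlquot_local_complemented (f : rlquot F) :
  local_rl A -> proper_rlfilter F -> complemented_set (rlquot F) f ->
  f = \bot \/ f = \top.
Proof.
move=> Al Fp; have [a <-] := rlproj_surjective f.
move=> [g]; have [b <-] := rlproj_surjective g => -[ab0 ab1].
apply: (complement_nilpotent ab0 ab1).
have Fc : rlfilter_set F ((a `&` b) \imp \bot).
  by apply/asboolP; rewrite -rlproj_leE rlprojI ab0.
have abc0 : a \odot b \odot ((a `&` b) \imp \bot) = \bot.
  apply/eqP; rewrite -lex0; apply: le_trans (rl_eval (a `&` b) \bot).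
  by rewrite [leRHS]rlmulC rlmul_monol// lexI rlmul_lel rlmulC rlmul_lel.
by have [an|bn] := local_rl_nilpotent Al Fp Fc abc0; [left|right];
  exact: rlproj_nilpotent.
Qed.

Lemma rlproj_bot_neq_top : proper_rlfilter F ->
  rlproj F \bot <> rlproj F \top.
Proof.
move=> /proper_rlfilterP[_ F0] e01; apply: F0.
have : rlproj F \top <= rlproj F \bot by rewrite e01.
rewrite rlproj_leE => /asboolP Ftb.
by apply: rlfilter_up Ftb _; rewrite -[leLHS]rlmulx1 rl_eval.
Qed.

Lemma rlquot_improper (f : rlquot F) : ~ proper_rlfilter F -> rlproj F \top = f.
Proof.
have [a <-] := rlproj_surjective f => nFp; apply/rlproj_eqP.
have F0 : rlfilter_set F \bot.
  apply: contrapT => F0; apply: nFp; apply/proper_rlfilterP; split=> //.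
  exact: rlfilterP.
exact: rlfilter_up F0 (le0x _).
Qed.

End QuotientOfLocal.

Theorem corollary4p34 (d : Order.disp_t) (A : residuatedLatticeType d)
    (hA : local_rl A) :
  has_BLP A /\
  (forall F : rlfilter A, proper_rlfilter F ->
     set_bij (complemented_set A) (complemented_set (rlquot F)) (rlproj F)).
Proof.
have lift (F : rlfilter A) : filter_has_BLP F.
  move=> f fB; have [Fp|nFp] := pselect (proper_rlfilter F); last first.
    by exists \top; [exact: complemented_top|exact: rlquot_improper].
  have [->|->] := rlquot_local_complemented hA Fp fB.
    by exists \bot; [exact: complemented_bot|exact: rlproj0].
  by exists \top; [exact: complemented_top|exact: rlproj1].
split=> // F Fp; split.
- move=> e [e' [ee0 ee1]]; exists (rlproj F e').
  by rewrite -rlprojI -rlprojU ee0 ee1 rlproj0 rlproj1.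
- have F01 := rlproj_bot_neq_top Fp.
  move=> e e' /set_mem eB /set_mem e'B.
  have [->|->] := local_rl_complemented hA eB;
    have [->|->] := local_rl_complemented hA e'B => // ee'.
  by case: F01.
- by move=> f /lift.
Qed.
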